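(* For every nonnegative integer $n$ and every $x \in \mathbb{R}$, we have \[ \int_0^x t^n\,dt = \frac{x^{n+1}}{n+1}. \]
   Context: The integral is the Riemann integral, with the convention $\int_0^x = -\int_x^0$ when $x < 0$ and $\int_0^0 = 0$. Here $t^0 = 1$ for all $t$. *)

(* Defs.v *)
From Stdlib Require Import Reals.
From Coquelicot Require Import Coquelicot.

(* Main.v *)
Require Import Defs.
From Stdlib Require Import Reals.
From Coquelicot Require Import Coquelicot.
Open Scope R_scope.

(** Fundamental theorem of calculus ([is_RInt_derive]) with antiderivative
    [t ^ (n + 1) / (INR n + 1)], which vanishes at 0; it covers both orientations, so the sign of
    [x] needs no cases. *)

(* [is_RInt f a b v]: f is Riemann integrable between a and b with integral v;
   oriented, so a > b is allowed.  [t ^ 0] is 1 for every t, including 0. *)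
Theorem theorem3p8 (n : nat) (x : R) :
  is_RInt (fun t : R => t ^ n) 0 x (x ^ (n + 1) / (INR n + 1)).
Proof.
  assert (Hn : INR n + 1 <> 0) by (rewrite <- S_INR; apply not_0_INR; discriminate).
  replace (x ^ (n + 1) / (INR n + 1))
    with (minus (x ^ (n + 1) / (INR n + 1)) (0 ^ (n + 1) / (INR n + 1))).
  - apply (is_RInt_derive (fun t : R => t ^ (n + 1) / (INR n + 1))); intros t _.
    + rewrite Nat.add_1_r.
      auto_derive; [exact I |].
      (* The [match] is the unfolded [INR (S n)], the factor brought down by the power rule. *)
      change (match n with 0%nat => 1 | S _ => INR n + 1 end) with (INR (S n)).
      rewrite S_INR; simpl pred; field; exact Hn.
    + apply (ex_derive_continuous (fun t : R => t ^ n)).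
      auto_derive; exact I.
  - unfold minus, plus, opp; simpl.
    (* The lower endpoint contributes 0 because the exponent is positive, even for [n = 0]. *)
    rewrite (pow_i (n + 1)) by (rewrite Nat.add_1_r; apply Nat.lt_0_succ).
    field; exact Hn.
Qed.
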